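(* For any fixed graph $G$ and any fixed $\epsilon > 0$, there is $N$ such that, for any $n \geq N$, we have $$\mathrm{ex}(n,G) \leq \frac{n^2}{2}\left(1 - \frac{1}{\chi(G)-1} + \epsilon\right).$$
   Context: All graphs considered are simple. The chromatic number $\chi(G)$ of a graph $G$ is the smallest natural number $c$ such that the vertices of $G$ can be colored with $c$ colors and no two vertices of the same color are adjacent. A graph $F$ is called $G$-free if it does not contain $G$ as a subgraph. The Turán number $\mathrm{ex}(n,G)$ is the maximum number of edges in an $n$-vertex $G$-free graph. *)

(* Defs.v *)
From HB Require Import structures.
From mathcomp Require Import all_boot.

Set Implicit Arguments.
Unset Strict Implicit.
Unset Printing Implicit Defensive.

(* A finite simple graph on the vertex type V: edges are 2-element subsets, so
   there are no loops, no multiple edges and adjacency is symmetric. *)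
Record sgraph (V : finType) := SGraph {
  edges : {set {set V}};
  edgesP : [forall e in edges, #|e| == 2] }.

HB.instance Definition _ (V : finType) := [isSub for @edges V].
(* There are finitely many graphs on V, so \max can range over sgraph V. *)
HB.instance Definition _ (V : finType) := [Finite of sgraph V by <:].

Definition adj (V : finType) (G : sgraph V) : rel V :=
  fun x y => [set x; y] \in edges G.

Definition proper_coloring (V : finType) (G : sgraph V) (c : nat)
    (f : {ffun V -> 'I_c}) : bool :=
  [forall x, forall y, adj G x y ==> (f x != f y)].

Definition colorable (V : finType) (G : sgraph V) (c : nat) : bool :=
  [exists f : {ffun V -> 'I_c}, proper_coloring G f].

Lemma adj_neq (V : finType) (G : sgraph V) (x y : V) : adj G x y -> x != y.
Proof.
move=> xy; have /forall_inP/(_ _ xy) := edgesP G.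
by rewrite cards2 eqSS eqb1.
Qed.

Lemma colorable_exists (V : finType) (G : sgraph V) :
  exists c, colorable G c.
Proof.
exists #|V|; apply/existsP; exists [ffun x => enum_rank x].
apply/forallP => x; apply/forallP => y; apply/implyP => /adj_neq.
by rewrite !ffunE; apply: contra_neq => /enum_rank_inj.
Qed.

Definition chromatic_number (V : finType) (G : sgraph V) : nat :=
  ex_minn (colorable_exists G).

(* Containment as a not necessarily induced subgraph, up to isomorphism. *)
Definition has_subgraph (V W : finType) (F : sgraph W) (G : sgraph V) : bool :=
  [exists f : {ffun V -> W},
    injectiveb f && [forall x, forall y, adj G x y ==> adj F (f x) (f y)]].

Definition subgraph_free (V W : finType) (G : sgraph V) (F : sgraph W) : bool :=
  ~~ has_subgraph F G.

(* Up to isomorphism every n-vertex graph has vertex set 'I_n.  A \max over no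
   graph is 0; this only occurs when G has no edges and at most n vertices. *)
Definition turan_number (V : finType) (n : nat) (G : sgraph V) : nat :=
  \max_(F : sgraph 'I_n | subgraph_free G F) #|edges F|.

(* Main.v *)
Require Import Defs.
From mathcomp Require Import all_boot all_order all_algebra.
From mathcomp Require Import reals ring lra.

Set Implicit Arguments.
Unset Strict Implicit.
Unset Printing Implicit Defensive.

Import Order.TTheory GRing.Theory Num.Theory.
Local Open Scope ring_scope.

(** Write r + 1 for the chromatic number of G.  A proper colouring with r + 1
colours embeds G into the complete (r + 1)-partite graph with parts of size
#|V|, so it suffices to find such a multipartite graph in every large graph
with more than (1 - 1/r + eps) n^2 / 2 edges.

Edge density is first traded for minimum degree.  Put d = 1 - 1/r + eps/2 and
choose a vertex set U that maximises arcs U - d #|U| (#|U| + 1), where arcs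
counts ordered pairs of adjacent vertices.  Deleting a vertex of U does not
increase this quantity, which says exactly that the vertex has degree at least
d #|U| inside U; and the quantity is of order n^2 at the full vertex set, so U
is large ([exists_min_degree_subset]).

The minimum degree statement [erdos_stone_min_degree] is an induction on the
number of parts.  Suppose that U already contains parts A_1, ..., A_r of a
large size m.  Every vertex of a part misses at most (1 - c) #|U| / r vertices
of U, so there are at most m (1 - c) #|U| non-adjacent pairs between the parts
and U.  A vertex of U with fewer than t neighbours in some part is responsible
for more than m - t of these pairs, whence a positive proportion of U has at
least t neighbours in every part ([many_well_attached]).  The union of the
parts has boundedly many subsets, so t of these vertices have the same
neighbourhood S in that union; together with t vertices of S in each part they
form r + 1 parts of size t ([complete_parts_extend]).

When the chromatic number is 0 or 1, or when eps >= 1, the right-hand side is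
at least n^2 / 2 and every graph satisfies the bound. *)

(** * Finite sets *)

Definition shrink (T : finType) (k : nat) (A : {set T}) : {set T} :=
  [set:: take k (enum A)].

Lemma shrink_sub (T : finType) (k : nat) (A : {set T}) : shrink k A \subset A.
Proof. by apply/subsetP => x; rewrite inE => /mem_take; rewrite mem_enum. Qed.

Lemma card_shrink (T : finType) (k : nat) (A : {set T}) :
  (k <= #|A|)%N -> #|shrink k A| = k.
Proof.
move=> kA; rewrite cardsE; have /card_uniqP -> := take_uniq k (enum_uniq A).
by rewrite size_takel // -cardE.
Qed.

(** The codomain is a set rather than a whole type because the bound must depend
only on the size of the parts already found, not on the host graph. *)
Lemma pigeonhole_fiber (T S : finType) (W : {set T}) (B : {set S})
    (h : T -> S) (m : nat) :
  (forall v, v \in W -> h v \in B) -> (m * #|B| < #|W|)%N ->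
  exists2 s, s \in B & (m <= #|[set v in W | h v == s]|)%N.
Proof.
move=> hB ltW; apply/exists_inP; apply: contraLR ltW => /exists_inPn small.
rewrite -leqNgt -sum1_card (partition_big h (mem B)) //= mulnC -sum_nat_const.
apply: leq_sum => s /small; rewrite -ltnNge => /ltnW; apply: leq_trans.
by rewrite -sum1_card; apply/eq_leq/eq_bigl => v; rewrite inE.
Qed.

(** * Degrees inside a vertex set *)

Definition degree_in (T : finType) (e : rel T) (U : {set T}) (v : T) : nat :=
  #|[set y in U | e v y]|.

Definition arcs (T : finType) (e : rel T) (U : {set T}) : nat :=
  \sum_(v in U) degree_in e U v.

Lemma degree_inE (T : finType) (e : rel T) (U : {set T}) (v : T) :
  degree_in e U v = (\sum_(y in U) e v y)%N.
Proof.
rewrite /degree_in -sum1_card big_mkcond [RHS]big_mkcond.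
by apply: eq_bigr => y _; rewrite inE; case: (y \in U); case: (e v y).
Qed.

Lemma arcs_le_sqr (T : finType) (e : rel T) (U : {set T}) :
  (arcs e U <= #|U| ^ 2)%N.
Proof.
rewrite -mulnn -sum_nat_const; apply: leq_sum => v _.
by apply/subset_leq_card/subsetP => y; rewrite inE => /andP[].
Qed.

Lemma card_non_neighbours (T : finType) (e : rel T) (U : {set T}) (v : T) :
  (#|[set y in U | ~~ e v y]| + degree_in e U v)%N = #|U|.
Proof.
rewrite addnC -(cardsID [set y | e v y] U); congr addn;
  by apply: eq_card => y; rewrite !inE // andbC.
Qed.

(** The factor two: the arcs lost with v are those leaving it and those entering
it. *)
Lemma arcsD1 (T : finType) (e : rel T) (U : {set T}) (v : T) :
  symmetric e -> irreflexive e -> v \in U ->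
  arcs e U = (arcs e (U :\ v) + (degree_in e U v).*2)%N.
Proof.
move=> esym eirr vU; rewrite /arcs (big_setD1 v) //=.
have -> : (\sum_(x in U :\ v) degree_in e U x =
           \sum_(x in U :\ v) e x v + \sum_(x in U :\ v) degree_in e (U :\ v) x)%N.
  rewrite -big_split /=; apply: eq_bigr => x _.
  by rewrite !degree_inE (big_setD1 v).
have -> : (\sum_(x in U :\ v) e x v)%N = degree_in e U v.
  rewrite degree_inE [RHS](big_setD1 v) //= eirr.
  by apply: eq_bigr => x _; rewrite esym.
by rewrite addnA addnn addnC.
Qed.

(** The term k (k + 1) is used in place of k^2 because its increment is exactly
2k: comparing the maximiser U with U minus a vertex then gives the degree bound
without an error term.  The second conclusion is what makes U large. *)
Lemma exists_min_degree_subset (R : realFieldType) (T : finType) (e : rel T)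
    (d : R) :
  symmetric e -> irreflexive e ->
  exists2 U : {set T},
    forall v, v \in U -> d * #|U|%:R <= (degree_in e U v)%:R &
    (arcs e [set: T])%:R - d * #|T|%:R * (#|T|%:R + 1) <=
      (arcs e U)%:R - d * #|U|%:R * (#|U|%:R + 1).
Proof.
move=> esym eirr.
pose phi (U : {set T}) : R := (arcs e U)%:R - d * #|U|%:R * (#|U|%:R + 1).
have [U _ Umax] : extremum_spec >=%R xpredT phi
    [arg max_(U > [set: T]) phi U]%O by exact: arg_maxP.
exists U => [v vU|]; last by have := Umax [set: T] isT; rewrite /phi cardsT.
have := Umax (U :\ v) isT; rewrite /= /phi (arcsD1 (U := U) esym eirr vU).
rewrite (cardsD1 v U) vU add1n -natr1 -addnn !natrD.
set a := (arcs _ _)%:R; set k := #|_|%:R; set g := (degree_in _ _ _)%:R.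
lra.
Qed.

(** * Complete multipartite subgraphs *)

(** For an irreflexive e, joined sets are automatically disjoint. *)
Definition joined (T : finType) (e : rel T) : rel {set T} :=
  fun A B => [forall x in A, forall y in B, e x y].

Lemma joinedP (T : finType) (e : rel T) (A B : {set T}) :
  reflect (forall x y, x \in A -> y \in B -> e x y) (joined e A B).
Proof.
apply: (iffP forall_inP) => [AB x y xA yB|AB x xA].
  by have /forall_inP := AB x xA; apply.
by apply/forall_inP => y; apply: AB.
Qed.

Lemma joinedS (T : finType) (e : rel T) (A A' B B' : {set T}) :
  A' \subset A -> B' \subset B -> joined e A B -> joined e A' B'.
Proof.
move=> /subsetP sA /subsetP sB /joinedP AB; apply/joinedP => x y /sA xA /sB yB.
exact: AB.
Qed.

(** The sets in s are the parts of a complete k-partite subgraph of U with parts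
of size t. *)
Definition complete_parts (T : finType) (e : rel T) (U : {set T}) (k t : nat)
    (s : seq {set T}) : Prop :=
  [/\ size s = k, pairwise (joined e) s
    & forall A, A \in s -> A \subset U /\ #|A| = t].

(** Double counting of the non-adjacent pairs between U and the parts.  The
condition on t makes m - t >= (1 - c/2) m, so that at most a proportion
(1 - c) / (1 - c/2) <= 1 - c/2 of U can be poorly attached to some part. *)
Lemma many_well_attached (R : realFieldType) (T : finType) (e : rel T)
    (U : {set T}) (r t m : nat) (c : R) (s : seq {set T}) :
  symmetric e -> 0 < c -> c < 1 -> (0 < m)%N -> t%:R <= c / 2 * m%:R ->
  complete_parts e U r.+1 m s ->
  (forall v, v \in U ->
     r.+1%:R * #|[set y in U | ~~ e v y]|%:R <= (1 - c) * #|U|%:R) ->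
  c / 2 * #|U|%:R <=
    #|[set v in U | all (fun A => t <= degree_in e A v)%N s]|%:R.
Proof.
move=> esym c0 c1 m0 tm [size_s _ parts] Udeg.
set W := [set v in U | _].
have WU : W \subset U by apply/subsetP => v; rewrite inE => /andP[].
pose bad (A : {set T}) v := #|[set u in A | ~~ e v u]|.
have upper : (\sum_(v in U) \sum_(A <- s) bad A v)%:R <=
    m%:R * ((1 - c) * #|U|%:R).
  have -> : (\sum_(v in U) \sum_(A <- s) bad A v =
     \sum_(A <- s) \sum_(u in A) #|[set v in U | ~~ e u v]|)%N.
    rewrite exchange_big /=; apply: eq_bigr => A _.
    have cntE (B : {set T}) v : #|[set u in B | ~~ e v u]| =
        (\sum_(u in B) ~~ e v u)%N.
      exact: (degree_inE (fun x y => ~~ e x y)).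
    under eq_bigr do rewrite /bad cntE.
    under [RHS]eq_bigr do rewrite cntE.
    rewrite exchange_big /=; apply: eq_bigr => u _; apply: eq_bigr => v _.
    by rewrite esym.
  rewrite -(ler_pM2l (x := r.+1%:R)) ?ltr0n // natr_sum mulr_sumr.
  have -> : r.+1%:R * (m%:R * ((1 - c) * #|U|%:R)) =
      \sum_(A <- s) m%:R * ((1 - c) * #|U|%:R) :> R.
    by rewrite big_const_seq count_predT size_s iter_addr_0 mulr_natl.
  rewrite !big_seq; apply: ler_sum => A /parts[/subsetP AU cardA].
  rewrite natr_sum mulr_sumr.
  have -> : m%:R * ((1 - c) * #|U|%:R) =
      \sum_(u in A) (1 - c) * #|U|%:R :> R by rewrite sumr_const cardA mulr_natl.
  by apply: ler_sum => u /AU; exact: Udeg.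
have lower : (#|U :\: W| * (m - t) <= \sum_(v in U) \sum_(A <- s) bad A v)%N.
  rewrite -sum_nat_const [leqRHS](big_setID W) /=.
  apply: leq_trans (leq_addl _ _); apply: leq_sum => v.
  rewrite !inE => /andP[+ vU]; rewrite vU /= -has_predC => /hasP[A As /=].
  rewrite -ltnNge => /ltnW small; have [_ cardA] := parts A As.
  rewrite (big_rem A) //=; apply: leq_trans (leq_addr _ _).
  by rewrite -cardA -(card_non_neighbours e A v) leq_subLR addnC leq_add2r.
have := le_trans _ upper; move/(_ (#|U :\: W| * (m - t))%:R).
rewrite ler_nat => /(_ lower).
have tm' : (t <= m)%N.
  rewrite -(ler_nat R); apply: le_trans tm _; rewrite -[leRHS]mul1r.
  by rewrite ler_wpM2r ?ler0n //; lra.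
rewrite natrM (natrB _ tm') cardsD (setIidPr WU) (natrB _ (subset_leq_card WU)).
have : #|W|%:R <= #|U|%:R :> R by rewrite ler_nat subset_leq_card.
have : 0 < m%:R :> R by rewrite ltr0n.
have : 0 <= #|W|%:R :> R by rewrite ler0n.
move: tm; set w := #|W|%:R; set u := #|U|%:R; set M := m%:R; set tt := t%:R.
move=> tm w0 M0 wu main.
have main2 : (u - w) * (M * (1 - c / 2)) <= M * ((1 - c) * u).
  by apply: le_trans main; apply: ler_wpM2l; lra.
have : (u - w) * (1 - c / 2) <= (1 - c) * u.
  by rewrite -(ler_pM2l M0) mulrCA.
have : 0 <= w * (c / 2) by apply: mulr_ge0 => //; lra.
lra.
Qed.

(** Vertices with the same neighbourhood S in the union K of the parts are joined
to all of S; as they have t neighbours in every part, S meets every part in at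
least t vertices.  They need not be chosen outside K: when e is irreflexive,
being joined to S keeps them out of S. *)
Lemma complete_parts_extend (T : finType) (e : rel T) (U : {set T})
    (r t m : nat) (s : seq {set T}) :
  symmetric e -> complete_parts e U r m s ->
  (t * 2 ^ (r * m) < #|[set v in U | all (fun A => t <= degree_in e A v) s]|)%N ->
  exists s', complete_parts e U r.+1 t s'.
Proof.
move=> esym [size_s pair_s parts]; set W := [set v in U | _] => ltW.
pose K := \bigcup_(A <- s) A; pose nbr v := [set u in K | e v u].
have cardK : (#|K| <= r * m)%N.
  apply: leq_trans (_ : \sum_(A <- s) #|A| <= _)%N.
    rewrite /K; elim: (s) => [|A l IH]; first by rewrite !big_nil cards0.
    rewrite !big_cons; apply: leq_trans (leq_card_setU _ _) _.
    by rewrite leq_add2l.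
  rewrite big_seq (eq_bigr (fun=> m)) => [|A /parts[]//].
  by rewrite -big_seq big_const_seq count_predT size_s iter_addn_0 mulnC.
have nbrK v : v \in W -> nbr v \in powerset K.
  by move=> _; rewrite powersetE; apply/subsetP => u; rewrite inE => /andP[].
have [|S _ cardS] := @pigeonhole_fiber _ _ W (powerset K) nbr t nbrK.
  rewrite card_powerset; apply: leq_ltn_trans ltW.
  by rewrite leq_mul2l leq_exp2l // cardK orbT.
have subK A : A \in s -> A \subset K.
  by move=> As; rewrite /K (big_rem A As) subsetUl.
set B := [set v in W | nbr v == S] in cardS.
have joinBS A : joined e B (A :&: S).
  apply/joinedP => x y; rewrite !inE => /andP[_ /eqP <-] /andP[_].
  by rewrite inE => /andP[].
have cardAS A : A \in s -> (t <= #|A :&: S|)%N.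
  (* The fiber is known to contain a vertex only when t > 0. *)
  move=> As; case: (posnP t) => [-> //|t0].
  have [v] : exists v, v \in B by apply/card_gt0P; exact: leq_trans cardS.
  rewrite !inE => /andP[/andP[vU /allP/(_ A As) +] /eqP <-].
  move/leq_trans; apply; apply/subset_leq_card/subsetP => u.
  rewrite !inE => /andP[uA ->]; rewrite uA andbT /=.
  by have /subsetP -> := subK A As.
exists (shrink t B :: [seq shrink t (A :&: S) | A <- s]); split => /=.
- by rewrite size_map size_s.
- apply/andP; split.
    apply/allP => _ /mapP[A As ->].
    exact: joinedS (shrink_sub _ _) (shrink_sub _ _) (joinBS A).
  rewrite pairwise_map; apply: sub_pairwise pair_s => A A'.
  by apply: joinedS; apply: subset_trans (shrink_sub _ _) (subsetIl _ _).
- move=> A; rewrite inE => /predU1P[->|/mapP[A' As ->]].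
    split; last exact: card_shrink.
    apply: subset_trans (shrink_sub _ _) _; apply/subsetP => v.
    by rewrite !inE => /andP[/andP[]].
  split; last exact/card_shrink/cardAS.
  apply: subset_trans (shrink_sub _ _) _.
  by apply: subset_trans (subsetIl _ _) _; have [] := parts _ As.
Qed.

(** The degree condition bounds the number of non-neighbours multiplied by r, so
that no division by r occurs: for r = 0 it always holds and any t vertices
form the single part, and the condition for r + 1 implies that for r. *)
Lemma erdos_stone_min_degree (R : realType) (r t : nat) (c : R) :
  0 < c -> c < 1 ->
  exists N : nat, forall (T : finType) (e : rel T) (U : {set T}),
    symmetric e -> (N <= #|U|)%N ->
    (forall v, v \in U ->
       r%:R * #|[set y in U | ~~ e v y]|%:R <= (1 - c) * #|U|%:R) ->
    exists s, complete_parts e U r.+1 t s.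
Proof.
move=> c0 c1; elim: r t => [|r IH] t.
  exists t => T e U _ tU _; exists [:: shrink t U]; split=> // A.
  by rewrite inE => /eqP ->; rewrite shrink_sub card_shrink.
have c20 : 0 < c / 2 by lra.
(* The parts found by induction must be so large that t is at most the fraction
   c / 2 of them; M below is t times the number of possible neighbourhoods. *)
pose m := (Num.bound (t%:R / (c / 2))).+1.
have tm : t%:R <= c / 2 * m%:R.
  rewrite mulrC -ler_pdivrMr //; apply: ltW.
  apply: lt_le_trans (archi_boundP _) _; first by rewrite divr_ge0 // ltW.
  by rewrite ler_nat.
have [N0 HN0] := IH m.
pose M := (t * 2 ^ (r.+1 * m))%N.
exists (maxn N0 (Num.bound (M%:R / (c / 2)))) => T e U esym.
rewrite geq_max => /andP[N0U NU] Udeg.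
have [|s parts] := HN0 T e U esym N0U.
  move=> v vU; apply: le_trans (Udeg v vU).
  by rewrite ler_wpM2r ?ler0n // ler_nat.
apply: (complete_parts_extend esym parts).
have many := many_well_attached esym c0 c1 (ltn0Sn _) tm parts Udeg.
rewrite -(ltr_nat R); apply: lt_le_trans many.
rewrite mulrC -ltr_pdivrMr //.
apply: lt_le_trans (archi_boundP _) _; first by rewrite divr_ge0 // ltW.
by rewrite ler_nat.
Qed.

(** * Embedding a graph by a colouring *)

Lemma adj_sym (V : finType) (G : sgraph V) : symmetric (adj G).
Proof. by move=> x y; rewrite /adj setUC. Qed.

Lemma adj_irr (V : finType) (G : sgraph V) : irreflexive (adj G).
Proof. by move=> x; apply/negP => /adj_neq; rewrite eqxx. Qed.

(** The vertices of colour i are sent injectively into the i-th part; the rank of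
a vertex in the whole of V serves as its index there, which is why the parts
have size #|V|. *)
Lemma has_subgraph_of_parts (V W : finType) (G : sgraph V) (F : sgraph W)
    (k : nat) (U : {set W}) (s : seq {set W}) :
  colorable G k -> complete_parts (adj F) U k #|V| s -> has_subgraph F G.
Proof.
move=> /existsP[col /forallP colP] [size_s /(pairwiseP set0) pair_s parts].
pose A (i : 'I_k) := nth set0 s i.
have cardA i : (#|V| <= #|A i|)%N.
  have [|_ ->] := parts (A i); last by [].
  by rewrite mem_nth // size_s.
have joinA i j : i != j -> forall x y, x \in A i -> y \in A j -> adj F x y.
  have lt_s (l : 'I_k) : (l : nat) \in gtn (size s) by rewrite inE size_s.
  rewrite neq_ltn => /orP[lt x y xA yA|lt x y xA yA].
    exact: (joinedP _ _ _ (pair_s _ _ (lt_s i) (lt_s j) lt)).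
  rewrite adj_sym.
  exact: (joinedP _ _ _ (pair_s _ _ (lt_s j) (lt_s i) lt)).
pose f x := enum_val (widen_ord (cardA (col x)) (enum_rank x)).
have fA x : f x \in A (col x) by exact: enum_valP.
apply/existsP; exists (finfun f); apply/andP; split.
  apply/injectiveP => x y; rewrite !ffunE => fxy.
  have [same|diff] := eqVneq (col x) (col y); last first.
    by have := joinA _ _ diff _ _ (fA x) (fA y); rewrite fxy adj_irr.
  move: fxy; rewrite /f; move: (cardA (col x)); rewrite same => h /enum_val_inj.
  by move=> /(congr1 val) /= /val_inj /enum_rank_inj.
apply/forallP => x; apply/forallP => y; apply/implyP => xy; rewrite !ffunE.
by apply: joinA (fA x) (fA y); have /forallP/(_ y)/implyP := colP x; apply.
Qed.

(** Counting incidences: each edge has two ends, and the edges at v correspond to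
neighbours of v through y |-> {v, y}. *)
Lemma edges_le_arcs (V : finType) (F : sgraph V) :
  (#|edges F| * 2 <= arcs (adj F) [set: V])%N.
Proof.
rewrite -sum_nat_const.
have -> : (\sum_(E in edges F) 2 = \sum_(E in edges F) \sum_(v in E) 1)%N.
  apply: eq_bigr => E EF; have /forall_inP/(_ E EF)/eqP := edgesP F.
  by rewrite sum1_card.
rewrite (exchange_big_dep xpredT) //= /arcs.
under [leqRHS]eq_bigl do rewrite inE.
apply: leq_sum => v _.
apply: leq_trans (leq_imset_card (fun y => [set v; y]) _).
rewrite sum1dep_card; apply/subset_leq_card/subsetP => E.
rewrite inE => /andP[EF vE].
have /forall_inP/(_ E EF)/cards2P[x [y [_ defE]]] := edgesP F.
move: EF vE; rewrite defE !inE => EF /orP[] /eqP vE; apply/imsetP.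
  by exists y; rewrite ?inE vE.
by exists x; rewrite ?inE /adj vE setUC.
Qed.

(** * From edge density to minimum degree *)

Lemma turan_number_le (R : realFieldType) (V : finType) (G : sgraph V) (n : nat)
    (b : R) :
  0 <= b ->
  (forall F : sgraph 'I_n, subgraph_free G F -> #|edges F|%:R <= b) ->
  (turan_number n G)%:R <= b.
Proof.
move=> b0 Fb; apply: (big_ind (fun m : nat => m%:R <= b)) => // p q pb qb.
by rewrite /maxn; case: ifP.
Qed.

Lemma edges_le (R : realFieldType) (n : nat) (F : sgraph 'I_n) :
  #|edges F|%:R <= n%:R ^+ 2 / 2 :> R.
Proof.
rewrite ler_pdivlMr ?ltr0n // -natrX -natrM ler_nat.
apply: leq_trans (edges_le_arcs F) _.
by apply: leq_trans (arcs_le_sqr _ _) _; rewrite cardsT card_ord.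
Qed.

Lemma inv_nat_bounds (R : realFieldType) (r : nat) :
  (0 < r)%N -> (0 < 1 / r%:R :> R) && (1 / r%:R <= 1 :> R).
Proof. by move=> r0; rewrite div1r invr_gt0 invf_le1 ?ltr0n // r0 ler1n. Qed.

(** If the subset U of large minimum degree had fewer than M vertices, then
arcs U <= M^2 while arcs U >= (eps/2) n^2 - d n, which fails once n is large. *)
Lemma erdos_stone (R : realType) (r t : nat) (eps : R) :
  (0 < r)%N -> 0 < eps -> eps < 1 ->
  exists N : nat, forall (n : nat) (F : sgraph 'I_n), (N <= n)%N ->
    n%:R ^+ 2 / 2 * (1 - 1 / r%:R + eps) < #|edges F|%:R ->
    exists U s, complete_parts (adj F) U r.+1 t s.
Proof.
move=> r0 eps0 eps1.
have r1 : 1 <= r%:R :> R by rewrite ler1n.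
have /andP[rinv0 rinv1] := inv_nat_bounds R r0.
have [M HM] := @erdos_stone_min_degree R r t (eps / 2) ltac:(lra) ltac:(lra).
exists (Num.bound ((2 + M%:R ^+ 2) / (eps / 2))).+1 => n F nN dense.
have n1 : 1 <= n%:R :> R by rewrite ler1n; apply: leq_trans nN.
have nbig : 2 + M%:R ^+ 2 <= eps / 2 * n%:R.
  rewrite mulrC -ler_pdivrMr; last by lra.
  apply: ltW; apply: lt_le_trans (archi_boundP _) _.
    by apply: divr_ge0; [apply: addr_ge0; rewrite ?exprn_ge0 ?ler0n|lra].
  by rewrite ler_nat; apply: leq_trans nN.
have [d dE] : exists d : R, d = 1 - 1 / r%:R + eps / 2 by eexists.
have [d0 d2] : 0 <= d /\ d <= 2 by rewrite dE; split; lra.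
have [U Udeg Uarcs] := exists_min_degree_subset d (@adj_sym _ F) (@adj_irr _ F).
have [s parts] : exists s, complete_parts (adj F) U r.+1 t s; last by exists U, s.
apply: HM; first exact: adj_sym.
- rewrite leqNgt; apply/negP => small.
  have small2 : (#|U| ^ 2)%:R <= M%:R ^+ 2 :> R.
    by rewrite -natrX ler_nat leq_exp2r // ltnW.
  have arcsU : (arcs (adj F) U)%:R <= (#|U| ^ 2)%:R :> R.
    by rewrite ler_nat arcs_le_sqr.
  have edgesF : #|edges F|%:R * 2 <= (arcs (adj F) [set: 'I_n])%:R :> R.
    by rewrite -natrM ler_nat edges_le_arcs.
  have dU : 0 <= d * #|U|%:R * (#|U|%:R + 1).
    by rewrite !mulr_ge0 ?addr_ge0 ?ler0n.
  move: Uarcs; rewrite card_ord => Uarcs.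
  have dn : d * n%:R <= 2 * n%:R by rewrite ler_wpM2r ?ler0n.
  have dense2 : n%:R ^+ 2 / 2 * (d + eps / 2) < #|edges F|%:R.
    by rewrite dE -addrA -mulrDl; move: dense; congr (_ * _ < _); lra.
  have nbig2 : n%:R * (2 + M%:R ^+ 2) <= n%:R * (eps / 2 * n%:R).
    by rewrite ler_wpM2l ?ler0n.
  have M2 : M%:R ^+ 2 <= n%:R * M%:R ^+ 2 :> R.
    by rewrite ler_peMl ?exprn_ge0 ?ler0n.
  lra.
- move=> v /Udeg.
  rewrite -(card_non_neighbours (adj F) U v) natrD.
  set b := #|_|%:R; set g := (degree_in _ _ _)%:R => dg.
  have rdg : r%:R * (d * (b + g)) <= r%:R * g by rewrite ler_pM2l ?ltr0n.
  have rd : r%:R * d = r%:R - 1 + r%:R * (eps / 2).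
    by rewrite dE; field; lra.
  have : eps / 2 * (b + g) <= r%:R * (eps / 2) * (b + g).
    rewrite ler_wpM2r ?addr_ge0 ?ler0n //; rewrite ler_peMl //; lra.
  move: rdg; rewrite mulrA rd; lra.
Qed.

Theorem theorem5p2 (R : realType) (V : finType) (G : sgraph V) (eps : R) :
  0 < eps ->
  exists N : nat, forall n : nat, (N <= n)%N ->
    (turan_number n G)%:R <= n%:R ^+ 2 / 2 *
                   (1 - 1 / ((chromatic_number G)%:R - 1) + eps) :> R.
Proof.
move=> eps0.
have easy_case : 0 <= - (1 / ((chromatic_number G)%:R - 1)) + eps ->
    exists N : nat, forall n : nat, (N <= n)%N ->
    (turan_number n G)%:R <= n%:R ^+ 2 / 2 *
                   (1 - 1 / ((chromatic_number G)%:R - 1) + eps) :> R.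
  move=> weak; exists 0%N => n _.
  have n2 : 0 <= n%:R ^+ 2 / 2 :> R by rewrite divr_ge0 ?exprn_ge0.
  apply: (@le_trans _ _ (n%:R ^+ 2 / 2)).
    by apply: turan_number_le => // F _; exact: edges_le.
  by rewrite ler_peMr //; lra.
have Gcol : colorable G (chromatic_number G).
  by rewrite /chromatic_number; case: ex_minnP.
move: Gcol easy_case; case: (chromatic_number G) => [|[|r]] Gcol easy_case.
- by apply: easy_case; rewrite sub0r invrN1 mul1r opprK; lra.
- by apply: easy_case; rewrite subrr invr0 mulr0 oppr0 add0r ltW.
have rE : r.+2%:R - 1 = r.+1%:R :> R by rewrite -natr1 addrK.
have /andP[rinv0 rinv1] := inv_nat_bounds R (ltn0Sn r).
have [eps1|eps1] := leP 1 eps.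
  by apply: easy_case; rewrite rE addrC subr_ge0; apply: le_trans eps1.
have [N HN] := @erdos_stone R r.+1 #|V| eps isT eps0 eps1.
rewrite rE; exists N => n nN; apply: turan_number_le.
  rewrite mulr_ge0 ?divr_ge0 ?exprn_ge0 // addr_ge0 ?(ltW eps0) //.
  by rewrite subr_ge0.
move=> F; apply: contraNle => /(HN n F nN)[U [s]].
exact: has_subgraph_of_parts Gcol.
Qed.
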